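(* Let $\mathsf{E}$ be a logic and let $\kappa=[N]$ for some $N\in\mathbb{N}$ or $\kappa=\mathbb{N}$. The subset $$\mathsf{U}_\kappa(\mathsf{E}):=\mathsf{D}_\kappa(\mathsf{E})^{**}=\{\mathbb{A}\in\mathsf{D}_\kappa(\mathsf{E}):\mathbb{A}^{**}=\mathbb{A}\}\subseteq\mathsf{D}_\kappa(\mathsf{E})$$ contains $\mathsf{E}^\kappa$; it can also be described as $$\mathsf{U}_\kappa(\mathsf{E})=\mathsf{D}_\kappa(\mathsf{E})^{*}=\{\mathbb{A}^{*}:\mathbb{A}\in\mathsf{D}_\kappa(\mathsf{E})\};$$ and it is equipped with an orthocomplemented complete lattice structure $(\mathsf{U}_\kappa(\mathsf{E}),\leq,\amalg,\wedge,*,\hat{\mathbf{0}},\hat{\mathbf{1}})$, where the order $\leq$ is inherited from $\mathsf{D}_\kappa(\mathsf{E})$, the infimum $\wedge$ of any subset is its infimum in $\mathsf{D}_\kappa(\mathsf{E})$, the orthocomplementation is the restriction of $*$, the bottom and top are $\hat{\mathbf{0}}$ and $\hat{\mathbf{1}}$, and the supremum is $$\coprod S=\Big(\bigvee S\Big)^{**},\qquad\forall S\subseteq\mathsf{U}_\kappa(\mathsf{E}),$$ with $\bigvee S$ the supremum in $\mathsf{D}_\kappa(\mathsf{E})$.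
   Context: A logic is a complete orthocomplemented (not necessarily distributive) lattice $(\mathsf{E},\subseteq,\cup,\cap,{}^c,\mathbf{0},\mathbf{1})$; an orthocomplementation is an order-reversing involution $^c$ such that $a^c$ is a complement of $a$. Here $[N]=\{1,\dots,N\}$, $N\geq1$. $\mathsf{E}^\kappa$ denotes the set of families $A=(a_n)_{n\in\kappa}$ with $a_n\in\mathsf{E}$, where all families having at least one component equal to $\mathbf{0}$ are identified with each other, i.e. with $\hat{\mathbf{0}}=(\mathbf{0},\mathbf{0},\dots)$; and $\hat{\mathbf{1}}=(\mathbf{1},\mathbf{1},\dots)$. The order is component-wise: $A\subseteq B$ iff $a_n\subseteq b_n$ for all $n$ (using the constant family to represent $\hat{\mathbf{0}}$); infima $\cap$ are computed component-wise (followed by the identification). A term is a function $i\in I\mapsto A^i\in\mathsf{E}^\kappa$, written $\bigsqcup_{i\in I}A^i$, with $|I|\leq2^{|\mathsf{E}^\kappa|}$; $\mathsf{T}(\mathsf{E}^\kappa)$ is the collection of terms. Put $\bigsqcup_{i\in I}A^i\backsim\bigsqcup_{j\in J}B^j$ iff for every $i\in I$ there is $j\in J$ with $A^i\subseteq B^j$ (if $J=\emptyset$: $A^i=\hat{\mathbf{0}}$), and for every $j\in J$ there is $i\in I$ with $B^j\subseteq A^i$ (if $I=\emptyset$: $B^j=\hat{\mathbf{0}}$). This is an equivalence relation; $\mathsf{D}_\kappa(\mathsf{E}):=\mathsf{T}(\mathsf{E}^\kappa)/\backsim$. For families with larger index sets, $[\bigsqcup_{i\in I}A^i]$ denotes the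 class of the terms equivalent (same condition) to the family. Every class has a representative with $I\neq\emptyset$, and such representatives are always used. Order: $[\bigsqcup_{i\in I}A^i]\leq[\bigsqcup_{j\in J}B^j]$ iff $[\bigsqcup_{i\in I}A^i\sqcup\bigsqcup_{j\in J}B^j]=[\bigsqcup_{j\in J}B^j]$ (here $\sqcup$ is the family on the disjoint union of $I$ and $J$). With it $\mathsf{D}_\kappa(\mathsf{E})$ is a complete lattice with suprema $\bigvee$, infima $\bigwedge$, bottom $[\hat{\mathbf{0}}]$ and top $[\hat{\mathbf{1}}]$. One regards $\mathsf{E}^\kappa\subseteq\mathsf{D}_\kappa(\mathsf{E})$ via the injection $A\mapsto[A]$; then $[\bigsqcup_{i\in I}A^i]=\bigvee_{i\in I}A^i$, so every element of $\mathsf{D}_\kappa(\mathsf{E})$ is of the form $\bigvee_{i\in I}A^i$ with $I\neq\emptyset$, $A^i=(a^i_n)_{n\in\kappa}\in\mathsf{E}^\kappa$. The function $*:\mathsf{D}_\kappa(\mathsf{E})\to\mathsf{D}_\kappa(\mathsf{E})$ is the (well-defined) function $$\Big(\bigvee_{i\in I}A^i\Big)^*=\bigvee_{f:I\to\kappa}\Big(\bigcap_{i\in f^{-1}(n)}(a^i_n)^c\Big)_{n\in\kappa},$$ where an empty meet in $\mathsf{E}$ is $\mathbf{1}$. $\mathbb{A}^{**}=(\mathbb{A}^* )^*$. *)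

(* Defs.v *)
From HB Require Import structures.
From mathcomp Require Import all_boot all_order.
From mathcomp Require Import generic_quotient.
From mathcomp Require Import boolp classical_sets.

Set Implicit Arguments.
Unset Strict Implicit.
Unset Printing Implicit Defensive.

Import Order.Theory.
Local Open Scope order_scope.
Local Open Scope classical_set_scope.
Local Open Scope quotient_scope.

(* A logic: a complete orthocomplemented lattice, not assumed distributive.   *)
(* [supremums S] and [infimums S] are the sets of least upper and greatest    *)
(* lower bounds of [S]; the binary operations are [lsup [set a; b]] and       *)
(* [linf [set a; b]].                                                         *)
Record logic (d : Order.disp_t) (T : porderType d) := Logic {
  lsup : set T -> T;
  linf : set T -> T;
  ocompl : T -> T;
  lbot : T;
  ltop : T;
  lsupP : forall S : set T, supremums S (lsup S);
  linfP : forall S : set T, infimums S (linf S);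
  lbotP : forall x, lbot <= x;
  ltopP : forall x, x <= ltop;
  ocompl_anti : forall x y, x <= y -> ocompl y <= ocompl x;
  ocomplK : involutive ocompl;
  ocompl_sup : forall x, lsup [set x; ocompl x] = ltop;
  ocompl_inf : forall x, linf [set x; ocompl x] = lbot
}.

HB.instance Definition _ (d : Order.disp_t) (T : porderType d) (A : set T) :=
  SubChoice.copy (set_type A) {x : T | x \in A}.
HB.instance Definition _ (d : Order.disp_t) (T : porderType d) (A : set T) :=
  [SubChoice_isSubPOrder of set_type A by <: with d].

(* The index set kappa: [N] with N >= 1 (encoded as {0, ..., N - 1}) or N.    *)
Inductive kappa := Upto (N : nat) of (0 < N)%N | Naturals.

Definition kappa_type (k : kappa) : Type :=
  match k with Upto N _ => 'I_N | Naturals => nat end.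

Coercion kappa_type : kappa >-> Sortclass.

Section Families.
Context (d : Order.disp_t) (E : porderType d) (L : logic E) (K : Type).

Definition fam_rel : rel (K -> E) := fun a b =>
  `[< a = b \/ ((exists n, a n = lbot L) /\ (exists n, b n = lbot L)) >].

Lemma fam_rel_refl : reflexive fam_rel.
Proof. by move=> a; apply/asboolP; left. Qed.

Lemma fam_rel_sym : symmetric fam_rel.
Proof.
by move=> a b; apply/asboolP/asboolP => -[->|[? ?]]; [left|right|left|right].
Qed.

Lemma fam_rel_trans : transitive fam_rel.
Proof.
move=> b a c /asboolP[->//|[ha hb]] /asboolP[<-|[_ hc]]; apply/asboolP.
  by right.
by right.
Qed.

Canonical fam_equiv := EquivRel fam_rel fam_rel_refl fam_rel_sym fam_rel_trans.

Definition Ek := {eq_quot fam_equiv}.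
HB.instance Definition _ := Choice.on Ek.
HB.instance Definition _ := EqQuotient.on Ek.

Definition fam (a : K -> E) : Ek := \pi_Ek a.
Definition fam0 : Ek := fam (fun=> lbot L).
Definition fam1 : Ek := fam (fun=> ltop L).

(* The components of an element of E^kappa, [fam0] being represented by the   *)
(* constant family; the representative of any other element is unique.        *)
Definition cmp (A : Ek) : K -> E :=
  if A == fam0 then fun=> lbot L else repr A.

Lemma famP a b : fam a = fam b <->
  (a = b \/ ((exists n, a n = lbot L) /\ (exists n, b n = lbot L))).
Proof. by split=> [/eqmodP/asboolP//|h]; apply/eqmodP/asboolP. Qed.

Lemma cmpK A : fam (cmp A) = A.
Proof. by rewrite /cmp; case: eqP => [->//|_]; exact: reprK. Qed.

Lemma cmp_inj : injective cmp.
Proof. by move=> A B h; rewrite -(cmpK A) h cmpK. Qed.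

Lemma cmp_fam0 n : cmp fam0 n = lbot L.
Proof. by rewrite /cmp eqxx. Qed.

Lemma cmp_fam a :
  cmp (fam a) = if `[< exists n, a n = lbot L >] then fun=> lbot L else a.
Proof.
case: asboolP => [[n an]|na].
  have -> : fam a = fam0 by apply/famP; right; split; exists n.
  by apply/funext => m; rewrite cmp_fam0.
have /famP[//|[_ //]] : fam (cmp (fam a)) = fam a by exact: cmpK.
Qed.

Definition Ek_le : rel Ek := fun A B => `[< forall n, cmp A n <= cmp B n >].

Lemma Ek_le_refl : reflexive Ek_le.
Proof. by move=> A; apply/asboolP. Qed.

Lemma Ek_le_anti : antisymmetric Ek_le.
Proof.
move=> A B /andP[/asboolP h1 /asboolP h2]; apply: cmp_inj.
by apply/funext => n; apply/le_anti; rewrite h1 h2.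
Qed.

Lemma Ek_le_trans : transitive Ek_le.
Proof.
move=> B A C /asboolP h1 /asboolP h2; apply/asboolP => n.
exact: le_trans (h1 n) (h2 n).
Qed.

HB.instance Definition _ := Order.Le_isPOrder.Build d Ek
  Ek_le_refl Ek_le_anti Ek_le_trans.

Lemma Ek_leP (A B : Ek) : (A <= B) <-> forall n, cmp A n <= cmp B n.
Proof. by split=> [/asboolP|/asboolP]. Qed.

Definition covered (I J : Type) (A : I -> Ek) (B : J -> Ek) : Prop :=
  forall i, (exists j, A i <= B j) \/ (~ inhabited J /\ A i = fam0).

Definition feq (I J : Type) (A : I -> Ek) (B : J -> Ek) : Prop :=
  covered A B /\ covered B A.

Lemma fam0_le A : fam0 <= A.
Proof. by apply/Ek_leP => n; rewrite cmp_fam0; exact: lbotP. Qed.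

Lemma covered_refl I (A : I -> Ek) : covered A A.
Proof. by move=> i; left; exists i. Qed.

Lemma covered_trans I J M (A : I -> Ek) (B : J -> Ek) (C : M -> Ek) :
  covered A B -> covered B C -> covered A C.
Proof.
move=> AB BC i; case: (AB i) => [[j ij]|[nJ ->]].
  case: (BC j) => [[m jm]|[nM B0]]; first by left; exists m; exact: le_trans jm.
  by right; split=> //; apply/le_anti; rewrite fam0_le -B0 ij.
have [[m]|nM] := EM (inhabited M); last by right.
by left; exists m; exact: fam0_le.
Qed.

Lemma feq_refl I (A : I -> Ek) : feq A A.
Proof. by split; exact: covered_refl. Qed.

Lemma feq_sym I J (A : I -> Ek) (B : J -> Ek) : feq A B -> feq B A.
Proof. by case. Qed.

Lemma feq_trans I J M (A : I -> Ek) (B : J -> Ek) (C : M -> Ek) :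
  feq A B -> feq B C -> feq A C.
Proof. by move=> [h1 h2] [h3 h4]; split; [apply: covered_trans h3|apply: covered_trans h2]. Qed.

(* Index sets of terms have cardinality at most that of the power set of      *)
(* E^kappa; they are taken to be subsets of it, so that terms form a type in  *)
(* the universe of E.                                                         *)
Record term := Term { tidx : set (set Ek); tfam : tidx -> Ek }.
HB.instance Definition _ := gen_eqMixin term.
HB.instance Definition _ := gen_choiceMixin term.

Definition term_rel : rel term := fun s t => `[< feq (@tfam s) (@tfam t) >].

Lemma term_rel_refl : reflexive term_rel.
Proof. by move=> s; apply/asboolP; exact: feq_refl. Qed.

Lemma term_rel_sym : symmetric term_rel.
Proof. by move=> s t; apply/asboolP/asboolP; exact: feq_sym. Qed.

Lemma term_rel_trans : transitive term_rel.
Proof.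
by move=> t s u /asboolP h1 /asboolP h2; apply/asboolP; exact: feq_trans h2.
Qed.

Canonical term_equiv :=
  EquivRel term_rel term_rel_refl term_rel_sym term_rel_trans.

Definition Dk := {eq_quot term_equiv}.
HB.instance Definition _ := Choice.on Dk.
HB.instance Definition _ := EqQuotient.on Dk.

Lemma small_term (I : Type) (A : I -> Ek) :
  exists t : term, feq A (@tfam t).
Proof.
pose J : set (set Ek) := [set X | exists i, X = [set A i]].
have Jex (X : J) : exists i, val X = [set A i] by have := valP X; rewrite inE.
exists (@Term J (fun X => A (sval (cid (Jex X))))); split=> [i|X]; left.
  have iJ : [set A i] \in J by rewrite inE; exists i.
  exists (exist (fun X => X \in J) _ iJ) => /=; case: cid => /= j.
  by move=> Aij; have : [set A i] (A i) by []; rewrite Aij => ->.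
by exists (sval (cid (Jex X))).
Qed.

(* Reindexing: restricting the index sets of terms loses no family indexed by *)
(* a set of cardinality at most that of the power set of E^kappa.             *)
Lemma term_reindex (I : Type) (c : I -> set Ek) (A : I -> Ek) :
  injective c -> exists t : term, exists g : tidx t -> I,
    bijective g /\ forall X, tfam X = A (g X).
Proof.
move=> cI; pose J : set (set Ek) := range c.
have Jex (X : J) : exists i, val X = c i.
  by have := valP X; rewrite inE => -[i _ <-]; exists i.
have iJ i : c i \in J by rewrite inE; exists i.
pose g X := sval (cid (Jex X)).
exists (@Term J (A \o g)), g; split=> //.
exists (fun i => exist (fun X => X \in J) (c i) (iJ i)) => [X|i].
  by apply: val_inj; rewrite /= /g; case: cid.
by rewrite /g; case: cid => j /= /cI.
Qed.

(* The class of the terms equivalent to a family with arbitrary index set.    *)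
Definition cls (I : Type) (A : I -> Ek) : Dk :=
  \pi_Dk (sval (cid (small_term A))).

Lemma pi_cls (t : term) : cls (@tfam t) = \pi_Dk t.
Proof. by rewrite /cls; case: cid => s /= st; apply/eqmodP/asboolP/feq_sym. Qed.

Lemma clsP (I J : Type) (A : I -> Ek) (B : J -> Ek) :
  cls A = cls B <-> feq A B.
Proof.
rewrite /cls; case: cid => s /= As; case: cid => t /= Bt; split.
  move=> /eqmodP/asboolP st; apply: (feq_trans As); apply: (feq_trans st).
  exact: feq_sym.
move=> AB; apply/eqmodP/asboolP; apply: feq_trans (feq_sym As) _.
exact: feq_trans Bt.
Qed.

Lemma nonempty_rep (x : Dk) :
  exists t : term, inhabited (tidx t) /\ \pi_Dk t = x.
Proof.
have [h|nI] := EM (inhabited (tidx (repr x))).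
  by exists (repr x); split=> //; exact: reprK.
exists (@Term [set set0] (fun=> fam0)); split.
  have h : set0 \in [set (set0 : set Ek)] by rewrite inE.
  by split; exists set0.
rewrite -[x]reprK; apply/eqmodP/asboolP.
by split=> [i|i]; [right|case: nI].
Qed.

Definition rep (x : Dk) : term := sval (cid (nonempty_rep x)).

Lemma rep_inh x : inhabited (tidx (rep x)).
Proof. by rewrite /rep; case: cid => t []. Qed.

Lemma repK x : cls (@tfam (rep x)) = x.
Proof. by rewrite pi_cls /rep; case: cid => t []. Qed.

Definition fsum (I J : Type) (A : I -> Ek) (B : J -> Ek) : I + J -> Ek :=
  fun s => match s with inl i => A i | inr j => B j end.

Definition Dk_le : rel Dk := fun x y =>
  let A := @tfam (rep x) in let B := @tfam (rep y) in
  `[< cls (fsum A B) = cls B >].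

Lemma fsum_covered (I J : Type) (A : I -> Ek) (B : J -> Ek) :
  cls (fsum A B) = cls B <-> covered A B.
Proof.
split=> [/clsP[h _] i|h]; first exact: (h (inl i)).
apply/clsP; split=> [[i|j]|j]; first exact: h.
  by left; exists j.
by left; exists (inr j).
Qed.

Lemma covered_feql (I I' J : Type) (A : I -> Ek) (A' : I' -> Ek)
  (B : J -> Ek) : feq A A' -> covered A B -> covered A' B.
Proof. by move=> [_ h] ?; exact: covered_trans h _. Qed.

Lemma covered_feqr (I J J' : Type) (A : I -> Ek) (B : J -> Ek)
  (B' : J' -> Ek) : feq B B' -> covered A B -> covered A B'.
Proof. by move=> [h _] h'; exact: covered_trans h. Qed.

Lemma Dk_leE (I J : Type) (A : I -> Ek) (B : J -> Ek) :
  Dk_le (cls A) (cls B) <-> covered A B.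
Proof.
have hA : feq (@tfam (rep (cls A))) A by apply/clsP; rewrite repK.
have hB : feq (@tfam (rep (cls B))) B by apply/clsP; rewrite repK.
split=> [/asboolP/fsum_covered h|h].
  exact: covered_feqr hB (covered_feql hA h).
apply/asboolP/fsum_covered.
exact: covered_feqr (feq_sym hB) (covered_feql (feq_sym hA) h).
Qed.

Lemma Dk_le_refl : reflexive Dk_le.
Proof. by move=> x; rewrite -(repK x); apply/Dk_leE/covered_refl. Qed.

Lemma Dk_le_anti : antisymmetric Dk_le.
Proof.
move=> x y; rewrite -(repK x) -(repK y).
by move=> /andP[/Dk_leE h1 /Dk_leE h2]; apply/clsP.
Qed.

Lemma Dk_le_trans : transitive Dk_le.
Proof.
move=> y x z; rewrite -(repK x) -(repK y) -(repK z).
by move=> /Dk_leE h1 /Dk_leE h2; apply/Dk_leE; exact: covered_trans h2.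
Qed.

HB.instance Definition _ := Order.Le_isPOrder.Build d Dk
  Dk_le_refl Dk_le_anti Dk_le_trans.

Lemma cls_le (I J : Type) (A : I -> Ek) (B : J -> Ek) :
  (cls A <= cls B) <-> covered A B.
Proof. exact: Dk_leE. Qed.

Lemma cls_leE (I J : Type) (A : I -> Ek) (B : J -> Ek) :
  (cls A <= cls B) <-> cls (fsum A B) = cls B.
Proof. by rewrite cls_le fsum_covered. Qed.

Definition emb (A : Ek) : Dk := cls (fun _ : unit => A).

Lemma emb_le A B : (emb A <= emb B) = (A <= B).
Proof.
apply/idP/idP => [/cls_le /(_ tt)[[]//|[[]//]]|AB].
by apply/cls_le => -[]; left; exists tt.
Qed.

Lemma emb_inj : injective emb.
Proof.
by move=> A B h; apply/le_anti; rewrite -!emb_le h lexx.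
Qed.

Lemma emb_fam0_le x : emb fam0 <= x.
Proof.
rewrite -(repK x); apply/cls_le => -[]; left.
by case: (rep_inh x) => j; exists j; exact: fam0_le.
Qed.

Lemma le_emb_fam1 x : x <= emb fam1.
Proof.
rewrite -(repK x); apply/cls_le => i; left; exists tt.
apply/Ek_leP => n; rewrite /fam1 cmp_fam.
case: asboolP => [[m tb]|_]; last exact: ltopP.
by rewrite -tb; exact: ltopP.
Qed.

Definition dsup (S : set Dk) : Dk := supremum (emb fam0) S.
Definition dinf (S : set Dk) : Dk := infimum (emb fam1) S.

Lemma Dk_supremums (S : set Dk) : exists x, supremums S x.
Proof.
pose T := {A : Ek | exists x, S x /\ emb A <= x}.
pose F : T -> Ek := sval.
exists (cls F); split=> [x Sx|y ub].
  rewrite -(repK x); apply/cls_le => i; left.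
  have h : exists x, S x /\ emb (tfam i) <= x.
    exists x; split=> //; rewrite -{2}(repK x); apply/cls_le => _.
    by left; exists i.
  by exists (exist (fun A => exists x, S x /\ emb A <= x) _ h).
rewrite -(repK y); apply/cls_le => -[A [x [Sx Ax]]]; left => /=.
have : emb A <= y by exact: le_trans Ax (ub _ Sx).
rewrite -{1}(repK y) => /cls_le /(_ tt)[//|[ne _]].
by case: ne; exact: rep_inh.
Qed.

Lemma dsupP (S : set Dk) : supremums S (dsup S).
Proof.
rewrite /dsup /supremum; case: eqP => [->|_].
  by split=> [x []|y _]; exact: emb_fam0_le.
by case: xgetP => [x -> //|]; have [x] := Dk_supremums S; move=> h /(_ x).
Qed.

Lemma dinfP (S : set Dk) : infimums S (dinf S).
Proof.
rewrite /dinf /infimum; case: eqP => [->|_].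
  by split=> [x []|y _]; exact: le_emb_fam1.
case: xgetP => [x -> //|]; have [h1 h2] := dsupP (lbound S).
move=> /(_ (dsup (lbound S)))[]; split=> [x Sx|x lx]; last exact: h1.
by apply: h2 => y; apply.
Qed.

Lemma clsE (I : Type) (A : I -> Ek) : cls A = dsup (range (emb \o A)).
Proof.
apply: (@is_subset1_supremums _ _ (range (emb \o A))); last exact: dsupP.
split=> [_ [i _ <-]|y ub].
  by apply/cls_le => -[]; left; exists i.
rewrite -(repK y); apply/cls_le => i; left.
have : emb (A i) <= y by apply: ub; exists i.
rewrite -{1}(repK y) => /cls_le /(_ tt)[//|[ne _]].
by case: ne; exact: rep_inh.
Qed.

Definition fstar (I : Type) (A : I -> Ek) : (I -> K) -> Ek := fun f =>
  fam (fun n => linf L [set ocompl L (cmp (A i) n) | i in [set i | f i = n]]).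

Definition star (x : Dk) : Dk := cls (fstar (@tfam (rep x))).

Lemma fam_mono (a b : K -> E) : (forall n, a n <= b n) -> fam a <= fam b.
Proof.
move=> ab; apply/Ek_leP => n; rewrite !cmp_fam.
case: (asboolP (exists n, b n = _)) => [[m bm]|_].
  rewrite asboolT //; exists m; apply/le_anti; rewrite lbotP andbT -bm.
  exact: ab.
by case: asboolP => _; [exact: lbotP|exact: ab].
Qed.

Lemma fstar_covered (I J : Type) (A : I -> Ek) (B : J -> Ek) :
  inhabited I -> covered B A -> covered (fstar A) (fstar B).
Proof.
move=> [i0] BA f; left.
have {BA} BA j : exists i, B j <= A i.
  by case: (BA j) => [//|[[]]]; split.
pose i j := sval (cid (BA j)).
have iP j : B j <= A (i j) by rewrite /i; case: cid.
exists (f \o i); apply: fam_mono => n.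
have [_ glb] := linfP L [set ocompl L (cmp (B j) n) | j in [set j | (f \o i) j = n]].
have [lb _] := linfP L [set ocompl L (cmp (A i) n) | i in [set i | f i = n]].
apply: glb => _ [j /= fj <-].
apply: (@le_trans _ _ (ocompl L (cmp (A (i j)) n))).
  by apply: lb; exists (i j).
by apply: ocompl_anti; have /Ek_leP := iP j; exact.
Qed.

Lemma star_cls (I : Type) (A : I -> Ek) :
  inhabited I -> star (cls A) = cls (fstar A).
Proof.
move=> hI; have [h1 h2] : feq (@tfam (rep (cls A))) A.
  by apply/clsP; rewrite repK.
apply/clsP; split; apply: fstar_covered => //; exact: rep_inh.
Qed.

(* The choice of representatives of the identified families is immaterial.   *)
Lemma star_fam (I : Type) (a : I -> K -> E) :
  inhabited I ->
  star (cls (fun i => fam (a i))) =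
  cls (fun f : I -> K =>
    fam (fun n => linf L [set ocompl L (a i n) | i in [set i | f i = n]])).
Proof.
move=> hI; rewrite star_cls //; apply/clsP; split=> f; left; last first.
  exists f; apply: fam_mono => n.
  have [_ glb] := linfP L
    [set ocompl L (cmp (fam (a i)) n) | i in [set i | f i = n]].
  have [lb _] := linfP L [set ocompl L (a i n) | i in [set i | f i = n]].
  apply: glb => _ [i fi <-]; apply: (@le_trans _ _ (ocompl L (a i n))).
    by apply: lb; exists i.
  by apply: ocompl_anti; rewrite cmp_fam; case: asboolP => // _; exact: lbotP.
have /choice[g gP] i : exists n, (exists m, a i m = lbot L) /\ a i n = lbot L \/
    ~ (exists m, a i m = lbot L) /\ n = f i.
  have [h|h] := EM (exists m, a i m = lbot L); last by exists (f i); right.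
  by case: (h) => m am; exists m; left.
exists g; apply: fam_mono => n.
have [lb _] := linfP L
  [set ocompl L (cmp (fam (a i)) n) | i in [set i | f i = n]].
have [_ glb] := linfP L [set ocompl L (a i n) | i in [set i | g i = n]].
apply: glb => _ [i /= gi <-]; case: (gP i) => [[_ ai]|[nai fi]].
  apply: (@le_trans _ _ (ltop L)); first exact: ltopP.
  by rewrite -gi ai -[ltop L](ocomplK L); apply: ocompl_anti; exact: lbotP.
by apply: lb; exists i; [rewrite /= -fi|rewrite cmp_fam asboolF].
Qed.

Definition Uk : set Dk := [set x | star (star x) = x].

End Families.

Arguments fam {d E} L {K}.
Arguments Uk {d E} L K.
Arguments fam0 {d E} L K.
Arguments fam1 {d E} L K.

(* Main.v *)
Require Import Defs.
From mathcomp Require Import all_boot all_order.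
From mathcomp Require Import boolp classical_sets.
Import Order.Theory.
Local Open Scope order_scope.
Local Open Scope classical_set_scope.

(** Identify an element [x] of the completion with the nonempty down-set of
    the families [A] such that [emb A <= x]; the order is then inclusion
    ([le_emb_ext]).  Call two families orthogonal when in some coordinate each
    lies below the orthocomplement of the other.  Choosing such a coordinate
    for every member of a term gives exactly the functions over which [star]
    takes its join, so [star x] is the set of the families orthogonal to
    every family below [x] ([le_starP]).

    Thus [star] is the polarity of a symmetric relation.  It is a Galois
    connection of the completion with itself ([star_galois]), which makes
    [star \o star] a closure operator and its fixed points coincide with the
    image of [star].  They form a complete lattice for the inherited order:
    infima of closed elements are closed, and suprema are obtained by closing
    the suprema of the completion.  On closed elements [star] is an
    order-reversing involution.

    Two further facts use more than the symmetry of orthogonality.  A family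
    orthogonal to itself has a coordinate [a <= ocompl a], hence is zero; so
    [x] and [star x] have infimum zero ([star_disjoint]), and the dual law
    follows by applying [star].  Each family [A] is closed
    ([star_star_emb]): it is cut out by the families equal to the
    orthocomplement of [A] in one coordinate and to the top in all others. *)

(** * Orthogonality of families *)

Section Orthogonality.
Context {d : Order.disp_t} {E : porderType d} (L : logic E) {K : Type}.

Local Notation bot := (fam0 L K).

Definition perp (A B : Ek L K) : Prop :=
  exists n, cmp A n <= ocompl L (cmp B n).

Lemma le_ocomplC (a b : E) : a <= ocompl L b -> b <= ocompl L a.
Proof. by move=> /(ocompl_anti L); rewrite ocomplK. Qed.

Lemma perp_sym (A B : Ek L K) : perp A B -> perp B A.
Proof. by move=> [n /le_ocomplC h]; exists n. Qed.

Lemma perp_le (A A' B : Ek L K) : A <= A' -> perp A' B -> perp A B.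
Proof. by move=> /Ek_leP h [n hn]; exists n; exact: le_trans hn. Qed.

Lemma fam_bot (A : Ek L K) n : cmp A n = lbot L -> A = bot.
Proof. by move=> h; rewrite -(cmpK A); apply/famP; right; split; exists n. Qed.

Lemma le_ocompl_bot (a : E) : a <= ocompl L a -> a = lbot L.
Proof.
move=> h; apply/le_anti; rewrite lbotP andbT -(ocompl_inf L a).
by apply: (linfP L _).2 => _ [->|->].
Qed.

Lemma perp_self (A : Ek L K) : perp A A -> A = bot.
Proof. by move=> [n /le_ocompl_bot]; exact: fam_bot. Qed.

(** A coordinate is needed here: over an empty index type no two families
    would be orthogonal. *)
Lemma perp_bot (A : Ek L K) : inhabited K -> perp bot A.
Proof. by move=> [n]; exists n; rewrite cmp_fam0; exact: lbotP. Qed.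

Lemma ocompl_top : ocompl L (ltop L) = lbot L.
Proof. by apply: le_ocompl_bot; rewrite ocomplK; exact: ltopP. Qed.

(** The probes: with [ocompl (cmp A n)] in coordinate [n] and the top
    elsewhere, being orthogonal to the probe forces [cmp C n <= cmp A n],
    since in any other coordinate a nonzero [C] is not below [ocompl top]. *)
Lemma perp_perp_le (A C : Ek L K) :
  (forall B, perp B A -> perp C B) -> C <= A.
Proof.
move=> CA; apply/Ek_leP => n.
pose b m := if `[< m = n >] then ocompl L (cmp A n) else ltop L.
have [[m bm]|nb] := EM (exists m, b m = lbot L); last first.
  have bE : cmp (fam L b) = b by rewrite cmp_fam asboolF.
  have [|m] := CA (fam L b); first by exists n; rewrite bE /b asboolT.
  rewrite bE /b; case: asboolP => [->|_]; first by rewrite ocomplK.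
  rewrite ocompl_top => cm.
  have /fam_bot -> : cmp C m = lbot L by apply/le_anti; rewrite cm lbotP.
  by rewrite cmp_fam0; exact: lbotP.
(* A probe with a zero coordinate is identified with zero and tests nothing;
   but then either [cmp A n] is the top, or the top of [E] is its bottom. *)
move: bm; rewrite /b; case: asboolP => [_ bm|_ tb].
  by rewrite -[cmp A n](ocomplK L) bm; apply: le_ocomplC; exact: lbotP.
by apply: le_trans (ltopP L _) _; rewrite tb; exact: lbotP.
Qed.

End Orthogonality.

(** * The star operation as a polarity *)

Section Polarity.
Context {d : Order.disp_t} {E : porderType d} (L : logic E) {K : Type}.
Hypothesis K0 : inhabited K.

Local Notation D := (Dk L K).
Local Notation bot := (emb (fam0 L K)).
Local Notation top := (emb (fam1 L K)).

Lemma emb_le_cls (I : Type) (A : Ek L K) (B : I -> Ek L K) :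
  inhabited I -> emb A <= cls B <-> exists i, A <= B i.
Proof.
move=> hI; split=> [/cls_le /(_ tt)[//|[]//]|[i Ai]].
by apply/cls_le => _; left; exists i.
Qed.

Lemma le_emb_ext (x y : D) :
  x <= y <-> forall A, emb A <= x -> emb A <= y.
Proof.
split=> [xy A Ax|h]; first exact: le_trans xy.
rewrite -(repK x) clsE; apply: (dsupP _).2 => _ [i _ <-]; apply: h.
by rewrite -{2}(repK x); apply/emb_le_cls; [exact: rep_inh|exists i].
Qed.

(** A choice function selecting a coordinate of orthogonality for each member
    of a term is exactly one of the functions over which [star] joins. *)
Lemma le_starP (B : Ek L K) (x : D) :
  emb B <= star x <-> forall A, emb A <= x -> perp L B A.
Proof.
have hI := rep_inh x; rewrite /star.
have fI : inhabited (tidx (rep x) -> K) by case: K0 => n; split=> _; exact: n.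
rewrite (emb_le_cls _ _ _ fI); split=> [[f Bf] A|h].
  rewrite -{1}(repK x) => /emb_le_cls -/(_ hI)[i Ai].
  apply/perp_sym/(perp_le _ _ _ _ Ai)/perp_sym.
  move: Bf; rewrite /fstar; set c := (X in fam L X) => Bf.
  have [z|nz] := EM (exists n, c n = lbot L).
    have -> : B = fam0 L K.
      apply/le_anti; rewrite fam0_le andbT; apply: le_trans Bf _.
      by apply/Ek_leP => n; rewrite cmp_fam asboolT // lbotP.
    exact: perp_bot.
  have cE : cmp (fam L c) = c by rewrite cmp_fam asboolF.
  have /Ek_leP {}Bf := Bf; rewrite cE in Bf.
  by exists (f i); apply: le_trans (Bf _) _; apply: (linfP L _).1; exists i.
have /choice[f fP] : forall i : tidx (rep x), perp L B (tfam i).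
  by move=> i; apply: h; rewrite -{2}(repK x); apply/emb_le_cls; last exists i.
exists f; rewrite -{1}(cmpK B); apply: fam_mono => n.
by apply: (linfP L _).2 => _ [i <- <-]; exact: fP.
Qed.

Lemma star_galois (x y : D) : x <= star y -> y <= star x.
Proof.
move=> /le_emb_ext xy; apply/le_emb_ext => B By; apply/le_starP => A Ax.
by apply: perp_sym; move: B By; apply/le_starP/xy.
Qed.

Lemma le_star_star (x : D) : x <= star (star x).
Proof. exact: star_galois. Qed.

Lemma star_anti (x y : D) : x <= y -> star y <= star x.
Proof. by move=> xy; apply: star_galois; exact: le_trans (le_star_star y). Qed.

Lemma star_star_star (x : D) : star (star (star x)) = star x.
Proof.
by apply/le_anti; rewrite le_star_star andbT; exact/star_anti/le_star_star.
Qed.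

Lemma Uk_star (x : D) : Uk L K (star x).
Proof. exact: star_star_star. Qed.

Lemma star_star_emb (A : Ek L K) : star (star (emb A)) = emb A.
Proof.
apply/le_anti; rewrite le_star_star andbT; apply/le_emb_ext => C /le_starP CA.
rewrite emb_le; apply: (perp_perp_le L) => B BA; apply: CA.
apply/le_starP => A'; rewrite emb_le => A'A.
exact/perp_sym/(perp_le _ _ _ _ A'A)/perp_sym.
Qed.

Lemma star_disjoint (x y : D) : y <= x -> y <= star x -> y = bot.
Proof.
move=> yx yx'; apply/le_anti; rewrite emb_fam0_le andbT.
apply/le_emb_ext => A Ay; rewrite emb_le.
have Ax : emb A <= x by exact: le_trans yx.
have /le_starP/(_ A Ax)/perp_self -> // : emb A <= star x by exact: le_trans yx'.
Qed.

Lemma star_bot : star bot = top.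
Proof.
by apply/le_anti; rewrite le_emb_fam1; apply: star_galois; exact: emb_fam0_le.
Qed.

Lemma star_star_dinf (S : set D) :
  S `<=` Uk L K -> star (star (dinf S)) = dinf S.
Proof.
move=> SU; apply/le_anti; rewrite le_star_star andbT.
apply: (dinfP S).2 => x Sx; rewrite -(SU x Sx).
by do 2 apply: star_anti; exact: (dinfP S).1.
Qed.

(** * The logic of closed elements *)

Local Notation U := (set_type (Uk L K)).

Definition closed_elt (x : D) (h : Uk L K x) : U := exist _ x (mem_set h).

Lemma Uk_val (x : U) : star (star (sval x)) = sval x.
Proof. exact: set_mem (svalP x). Qed.

Lemma Uk_leE (x y : U) : (x <= y) = (sval x <= sval y).
Proof. by []. Qed.

Lemma Uk_dinf (S : set U) : Uk L K (dinf (sval @` S)).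
Proof. by apply: star_star_dinf => _ [x _ <-]; exact: Uk_val. Qed.

Definition Usup (S : set U) : U := closed_elt _ (Uk_star (star (dsup (sval @` S)))).
Definition Uinf (S : set U) : U := closed_elt _ (Uk_dinf S).
Definition Ucompl (x : U) : U := closed_elt _ (Uk_star (sval x)).
Definition Ubot : U := closed_elt _ (star_star_emb (fam0 L K)).
Definition Utop : U := closed_elt _ (star_star_emb (fam1 L K)).

Lemma UsupP (S : set U) : supremums S (Usup S).
Proof.
split=> [x Sx|y ub]; rewrite Uk_leE /=.
  apply: le_trans (le_star_star _).
  by apply: (dsupP _).1; exists x.
rewrite -(Uk_val y); do 2 apply: star_anti.
by apply: (dsupP _).2 => _ [x Sx <-]; exact: ub.
Qed.

Lemma UinfP (S : set U) : infimums S (Uinf S).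
Proof.
split=> [x Sx|y lb]; rewrite Uk_leE /=.
  by apply: (dinfP _).1; exists x.
by apply: (dinfP _).2 => _ [x Sx <-]; exact: lb.
Qed.

Lemma UbotP (x : U) : Ubot <= x.
Proof. by rewrite Uk_leE emb_fam0_le. Qed.

Lemma UtopP (x : U) : x <= Utop.
Proof. by rewrite Uk_leE le_emb_fam1. Qed.

Lemma Ucompl_anti (x y : U) : x <= y -> Ucompl y <= Ucompl x.
Proof. exact: star_anti. Qed.

Lemma UcomplK : involutive Ucompl.
Proof. by move=> x; apply: val_inj; exact: Uk_val. Qed.

Lemma Ucompl_inf (x : U) : Uinf [set x; Ucompl x] = Ubot.
Proof.
have lb := (UinfP [set x; Ucompl x]).1.
apply: val_inj; apply: (star_disjoint (sval x)).
  by apply: (lb x); left.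
by apply: (lb (Ucompl x)); right.
Qed.

(** The complement of the supremum lies below both [star x] and
    [star (star x)], hence is zero by [star_disjoint]. *)
Lemma Ucompl_sup (x : U) : Usup [set x; Ucompl x] = Utop.
Proof.
set s := Usup _; have ub := (UsupP [set x; Ucompl x]).1.
have s0 : star (sval s) = bot.
  apply: (star_disjoint (star (sval x))); apply: star_anti.
    by apply: (ub x); left.
  by apply: (ub (Ucompl x)); right.
by apply: val_inj; rewrite /= -star_bot -s0; exact/esym/Uk_val.
Qed.

Definition Uk_logic : logic U :=
  Logic UsupP UinfP UbotP UtopP Ucompl_anti UcomplK Ucompl_sup Ucompl_inf.

End Polarity.

Lemma kappa_inhabited (k : kappa) : inhabited k.
Proof. by case: k => [N N0|]; split; [exact: (Ordinal N0)|exact: 0%N]. Qed.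

Theorem theorem19 (d : Order.disp_t) (E : porderType d) (L : logic E)
    (k : kappa) :
  [/\ range (fun x : Dk L k => star (star x)) = Uk L k,
      (forall A : Ek L k, Uk L k (emb A)),
      Uk L k = range (@star _ _ L k),
      (forall x y : Uk L k, (x <= y) = (sval x <= sval y)) &
      exists M : logic (Uk L k),
        [/\ (forall S : set (Uk L k),
              sval (lsup M S) = star (star (dsup (sval @` S)))),
            (forall S : set (Uk L k), sval (linf M S) = dinf (sval @` S)),
            (forall x : Uk L k, sval (ocompl M x) = star (sval x)),
            sval (lbot M) = emb (fam0 L k) &
            sval (ltop M) = emb (fam1 L k)]].
Proof.
have k0 := kappa_inhabited k; split.
- apply/seteqP; split=> [_ [x _ <-]|x Ux]; first exact: Uk_star.
  by exists x.
- by move=> A; exact: star_star_emb.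
- apply/seteqP; split=> [x Ux|_ [x _ <-]]; last exact: Uk_star.
  by exists (star x).
- exact: Uk_leE.
- by exists (Uk_logic L k0).
Qed.
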